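(* Let $D\ge 3$. Let $f:[0,+\infty)\to\mathbb{R}$ be a $C^1$ function with $f\not\equiv 0$, $f(0)=0$, $f(t)>0$ for $t>0$, satisfying the Keller-Osserman condition $\int^{+\infty}\frac{ds}{\sqrt{F(s)}}<+\infty$. Let $\rho:\mathbb{R}^D\to(0,+\infty)$ be a $C^1$ function satisfying $\lim_{|x|\to+\infty}\int_{\mathbb{R}^D}|x-y|^{2-D}\rho(y)\,dy=0$. Let $u$ be a bounded solution of $$\Delta u=\rho(x)f(u),\quad u>0\qquad\text{in }\mathbb{R}^D.$$ Then there exists $\beta\in(0,+\infty)$ such that $\lim_{|x|\to+\infty}u(x)=\beta$.
   Context: Here $F(s)=\int_a^s f(t)\,dt$, where $a>0$ is a fixed constant (since $f>0$ on $(0,+\infty)$, any $a>0$ may be used), and $\int^{+\infty}$ means integration over a neighborhood $[s_0,+\infty)$ of $+\infty$ with some $s_0>a$. Solutions are classical ($C^2(\mathbb{R}^D)$). *)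

(* Defs.v *)
From HB Require Import structures.
From mathcomp Require Import all_boot all_order all_algebra.
From mathcomp Require Import all_classical all_reals all_analysis.
Set Implicit Arguments.
Unset Strict Implicit.
Unset Printing Implicit Defensive.
Import Order.TTheory GRing.Theory Num.Theory.
Import numFieldNormedType.Exports.
Local Open Scope classical_set_scope.
Local Open Scope ring_scope.

(* The library has no Lebesgue measure on R^n. Here it is the n-fold product of
   [lebesgue_measure], on n-tuples with their product sigma-algebra. *)
Section lebesgue_tuple.
Context {R : realType}.
Local Notation tupleR n := (n.-tuple (measurableTypeR R)).

Definition tuple_cons n (p : measurableTypeR R * tupleR n) : tupleR n.+1 :=
  [tuple of p.1 :: p.2].

Lemma measurable_tuple_cons n : measurable_fun setT (@tuple_cons n).
Proof. exact: measurable_cons. Qed.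

Section step.
Variables (n : nat) (mu : {sigma_finite_measure set (tupleR n) -> \bar R}).

Definition lebesgue_tuple_step : set (tupleR n.+1) -> \bar R :=
  pushforward (@lebesgue_measure R \x mu)%E (@tuple_cons n).

Let mpreimage (A : set (tupleR n.+1)) :
  measurable A -> measurable (@tuple_cons n @^-1` A).
Proof.
by move=> mA; rewrite -[X in measurable X]setTI; exact: measurable_tuple_cons.
Qed.

Let step0 : lebesgue_tuple_step set0 = 0%E.
Proof. by rewrite /lebesgue_tuple_step /pushforward preimage_set0 measure0. Qed.

Let step_ge0 A : (0 <= lebesgue_tuple_step A)%E.
Proof. by rewrite /lebesgue_tuple_step /pushforward; exact: measure_ge0. Qed.

Let step_sigma_additive : semi_sigma_additive lebesgue_tuple_step.
Proof.
move=> F mF tF mUF; rewrite /lebesgue_tuple_step /pushforward preimage_bigcup.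
apply: measure_semi_sigma_additive.
- by move=> k; exact: mpreimage.
- apply/trivIsetP => /= i j _ _ ij; rewrite -preimage_setI.
  by move/trivIsetP : tF => /(_ _ _ _ _ ij) ->//; rewrite preimage_set0.
- by rewrite -preimage_bigcup; exact: mpreimage.
Qed.

HB.instance Definition _ := isMeasure.Build _ _ _ lebesgue_tuple_step
  step0 step_ge0 step_sigma_additive.

Let uncons (t : tupleR n.+1) : measurableTypeR R * tupleR n :=
  (thead t, [tuple of behead t]).

Let tuple_consK : cancel (@tuple_cons n) uncons.
Proof. by case=> x y; congr pair; apply: val_inj. Qed.

Let unconsK : cancel uncons (@tuple_cons n).
Proof. by move=> t; rewrite [RHS]tuple_eta; apply: val_inj. Qed.

Let measurable_uncons : measurable_fun setT uncons.
Proof.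
apply/measurable_fun_pairP; split.
  exact: (measurable_tnth ord0).
exact: measurable_behead.
Qed.

Let step_sigma_finite : sigma_finite setT lebesgue_tuple_step.
Proof.
have /sigma_finiteP[F [TF ndF Foo]] := sigma_finiteT (@lebesgue_measure R).
have /sigma_finiteP[G [TG ndG Goo]] := sigma_finiteT mu.
exists (fun k => uncons @^-1` (F k `*` G k)).
  rewrite -preimage_bigcup -[LHS](preimage_setT uncons); congr (_ @^-1` _).
  rewrite -setXTT TF TG predeqE => -[x y]; split.
    move=> [/= [i _ Fix] [k _ Gky]]; exists (maxn i k) => //; split.
    - by move: x Fix; exact/subsetPset/ndF/leq_maxl.
    - by move: y Gky; exact/subsetPset/ndG/leq_maxr.
  by move=> [i _ []/= ? ?]; split; exists i.
move=> k; have [? ?] := Foo k; have [? ?] := Goo k; split.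
  rewrite -[X in measurable X]setTI; apply: measurable_uncons => //.
  exact: measurableX.
rewrite /lebesgue_tuple_step /pushforward -comp_preimage.
rewrite (_ : uncons \o _ = id) ?preimage_id//; last first.
  by apply/funext => p; exact: tuple_consK.
by rewrite product_measure1E// lte_mul_pinfty// ge0_fin_numE.
Qed.

HB.instance Definition _ := Measure_isSigmaFinite.Build _ _ _
  lebesgue_tuple_step step_sigma_finite.

End step.

Fixpoint lebesgue_tuple n : {sigma_finite_measure set (tupleR n) -> \bar R} :=
  if n is n'.+1 then lebesgue_tuple_step (lebesgue_tuple n')
  else dirac ([tuple] : tupleR 0).

End lebesgue_tuple.

Section euclidean.
Context {R : realType} {n : nat}.
Implicit Types (x : 'rV[R]_n) (g : 'rV[R]_n -> R).

Definition rowt (t : n.-tuple R) : 'rV[R]_n := \row_i tnth t i.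

(* The library norm on ['rV[R]_n] is the sup norm. *)
Definition enorm x : R := Num.sqrt (\sum_i x 0 i ^+ 2).

(* The filter |x| -> +oo. *)
Definition enorm_pinfty : set_system 'rV[R]_n :=
  filter_from setT (fun M : R => [set x | M < enorm x]).

Global Instance enorm_pinfty_filter : Filter enorm_pinfty.
Proof.
apply: filter_from_filter; first by exists 0.
move=> M N _ _; exists (Num.max M N) => // x /=.
by rewrite gt_max => /andP[].
Qed.

Definition basis_rV (i : 'I_n) : 'rV[R]_n := delta_mx 0 i.

Definition partial (i : 'I_n) g : 'rV[R]_n -> R := fun x => 'D_(basis_rV i) g x.

(* [is_Ck k g] : g is of class C^k on the whole space. *)
Fixpoint is_Ck k g : Prop :=
  continuous g /\
  if k is k'.+1 then
    forall i, (forall x, derivable g x (basis_rV i)) /\ is_Ck k' (partial i g)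
  else True.

Definition laplacian g x : R := \sum_i partial i (partial i g) x.

(* The integral of |x - y|^(2 - n) g(y) over R^n; it may be +oo. *)
Definition newton_integral g x : \bar R :=
  (\int[@lebesgue_tuple R n]_y
     (enorm (x - rowt y) ^ (2 - n%:Z) * g (rowt y))%:E)%E.

End euclidean.

Section half_line.
Context {R : realType}.
Implicit Type f : R -> R.

(* C^1 on the closed half-line: the difference quotients are taken within
   [0, +oo[, so the derivative at 0 is one-sided and the values of f at negative
   arguments are irrelevant. *)
Definition is_C1_halfline f : Prop :=
  exists2 f' : R -> R,
    forall t, 0 <= t ->
      (f s - f t) / (s - t) @[s --> within `[0, +oo[ t^'] --> f' t &
    {within `[0, +oo[, continuous f'}.

Definition primitive_from (a : R) f (s : R) : R :=
  (\int[lebesgue_measure]_(t in `[a, s]) f t)%R.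

Definition keller_osserman (a : R) f : Prop :=
  exists2 s0, a < s0 &
    (\int[lebesgue_measure]_(s in `[s0, +oo[)
       ((Num.sqrt (primitive_from a f s))^-1)%:E < +oo)%E.

End half_line.

(* Main.v *)
Require Import Defs.
From mathcomp Require Import all_boot all_order all_algebra.
From mathcomp Require Import all_classical all_reals all_analysis.
From mathcomp Require Import measurable_realfun zify ring lra.
Import Order.TTheory GRing.Theory Num.Theory.
Import numFieldNormedType.Exports.
Local Open Scope classical_set_scope.
Local Open Scope ring_scope.

Set Implicit Arguments.
Unset Strict Implicit.
Unset Printing Implicit Defensive.

(** Since [f (u x) > 0], the solution [u] is subharmonic; since [f] is bounded
    on the range of [u], its Laplacian is at most [A * rho] for a constant [A].
    If [W >= 0] satisfies [- laplacian W >= rho], then [u + A * W] is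
    superharmonic and lies above [u].

    Let [s] be the reflection in a hyperplane [z_i = c].  The function
    [z |-> u z - (u + A * W) (s z)] is subharmonic, bounded above, and
    nonpositive on the hyperplane, which [s] fixes; by a Phragmen-Lindelof
    argument on the half-space it is nonpositive there.  Hence
    [u x <= u y + A * W y] as soon as [x] and [y] differ in one coordinate only
    ([reflection_comparison]).  Reflections in coordinate hyperplanes commute
    with second partial derivatives up to sign, so one-variable calculus along
    coordinate lines is enough.

    The natural choice of [W] is the Newtonian potential of [rho], but it need
    not be easy to differentiate twice.  The comparison is made on half-boxes of
    increasing size, so [W] may depend on the box, provided that [W y] is
    bounded by a fixed multiple of [newton_integral rho y].  A finite sum does
    it ([discrete_potential]): cut the box into small cubes, put at the corner
    of each cube its approximate [rho]-mass, and give each mass the potential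
    [(a + |x - y|^2)^((2 - n) / 2)] with [a] comparable to the squared diameter
    of a cube.  Each term is smooth and superharmonic, the term of the cube that
    contains [x] alone contributes a multiple of [- rho x] to the Laplacian, and
    the whole sum is, up to a constant, a lower sum of the Newtonian integral.

    Finally let [x] be arbitrary and [y] far away.  Passing from [x] to [y] one
    coordinate at a time, and starting with a coordinate in which [y] is large,
    all points met after the first step are far away, where the Newtonian
    integral is small ([le_far_point]).  So [u x <= u y + e] for every [x], which
    means that [u y] tends to [sup u], and [sup u > 0]. *)

(** * Laplacians along coordinate lines *)

(** If [g2 > 0] then, as [g1 0 = 0], the derivative is positive just to the right
    of [0] and the mean value theorem makes [g] exceed [g 0] there. *)
Lemma second_derivative_at_max (R : realType) (g g1 : R -> R) (g2 : R) :
  (forall t : R, is_derive t 1 g (g1 t)) -> is_derive (0 : R) 1 g1 g2 ->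
  (\forall t \near (0 : R), g t <= g 0) -> g2 <= 0.
Proof.
move=> dg dg1 [e /= e0 gmax]; rewrite leNgt; apply/negP => g2_gt0.
have g10 : g1 0 = 0.
  have d0 : is_derive (0 : R) 1 g 0.
    apply: (@derive1_at_max _ g (- e) e) => [|t _||t].
    - by lra.
    - by have [] := dg t.
    - by rewrite in_itv/=; lra.
    - by rewrite in_itv/= => te; apply: gmax; rewrite /= sub0r normrN ltr_norml.
  by rewrite -(@derive_val _ _ _ _ _ _ _ (dg 0)) derive_val.
have [d /= d0 hd] : \forall h \near 0^', 0 < h^-1 *: (g1 h - g1 0).
  have [cg1 vg1] := dg1.
  have : h^-1 *: (g1 h - g1 0) @[h --> 0^'] --> g2.
    rewrite -vg1; move: cg1; rewrite /derivable /derive.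
    suff -> : (fun h : R => h^-1 *: ((g1 \o shift 0) (h *: 1) - g1 0)) =
      (fun h => h^-1 *: (g1 h - g1 0)) by [].
    by apply/funext => h /=; rewrite addr0 /GRing.scale/= mulr1.
  by move/cvgr_gt; exact.
pose t := Num.min d e / 2.
have m0 : 0 < Num.min d e by rewrite lt_min d0 e0.
have [md me] : Num.min d e <= d /\ Num.min d e <= e.
  by split; rewrite ge_min lexx ?orbT.
have t0 : 0 < t by rewrite /t; lra.
have [c c0t gE] : exists2 c, c \in `]0, t[%R & g t - g 0 = g1 c * (t - 0).
  apply: MVT => //; apply: derivable_within_continuous => x _.
  by have [] := dg x.
move: c0t; rewrite in_itv/= => /andP[c0 ct].
have g1c : 0 < g1 c.
  have := hd c; rewrite /= sub0r normrN gtr0_norm// g10 subr0 gt_eqF//.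
  rewrite /GRing.scale/= pmulr_rgt0 ?invr_gt0//; apply => //.
  by move: ct; rewrite /t; lra.
have := gmax t; rewrite /= sub0r normrN gtr0_norm// => /(_ _).
have : 0 < g t - g 0 by rewrite gE subr0 mulr_gt0.
move=> h /(_ _) hh; have : g t <= g 0 by apply: hh; rewrite /t; lra.
by lra.
Qed.

Section line_laplacian.
Context {R : realType} {n : nat}.
Implicit Types (g : 'rV[R]_n -> R) (p : 'rV[R]_n) (j : 'I_n).

Definition second_along g j p (d : R) : Prop :=
  exists g1 : R -> R,
    (forall t : R, is_derive t 1 (fun s : R => g (p + s *: basis_rV j)) (g1 t)) /\
    is_derive (0 : R) 1 g1 d.

(** The Laplacian as a relation at one point, defined through second derivatives
    along coordinate lines: unlike [laplacian] it adds up and composes with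
    reflections without side conditions of differentiability. *)
Definition lap_at g p (l : R) : Prop :=
  exists2 d : 'I_n -> R, (forall j, second_along g j p (d j)) & l = \sum_j d j.

Lemma lap_atD g h p l k : lap_at g p l -> lap_at h p k ->
  lap_at (fun x => g x + h x) p (l + k).
Proof.
move=> [d gd ->] [e he ->]; exists (fun j => d j + e j); last by rewrite big_split.
move=> j; have [g1 [g1P g2P]] := gd j; have [h1 [h1P h2P]] := he j.
by exists (g1 + h1); split=> [t|]; exact: is_deriveD.
Qed.

Lemma lap_atZ (a : R) g p l : lap_at g p l -> lap_at (fun x => a * g x) p (a * l).
Proof.
move=> [d gd ->]; exists (fun j => a * d j); last by rewrite mulr_sumr.
move=> j; have [g1 [g1P g2P]] := gd j.
by exists (a \*: g1); split=> [t|]; exact: is_deriveZ.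
Qed.

Lemma lap_at0 p : lap_at (fun=> 0) p 0.
Proof.
exists (fun=> 0); last by rewrite big1.
by move=> j; exists (cst 0); split=> [t|]; exact: is_derive_cst.
Qed.

Lemma lap_at_sum (I : Type) (s : seq I) (g : I -> 'rV[R]_n -> R) p (l : I -> R) :
  (forall k, lap_at (g k) p (l k)) ->
  lap_at (fun x => \sum_(k <- s) g k x) p (\sum_(k <- s) l k).
Proof.
move=> gl; elim: s => [|k s IH].
  rewrite big_nil; under [X in lap_at X]eq_fun do rewrite big_nil.
  exact: lap_at0.
rewrite big_cons; under [X in lap_at X]eq_fun do rewrite big_cons.
exact: lap_atD.
Qed.

Lemma lap_at_max g p l : lap_at g p l ->
  (forall j, \forall t \near (0 : R), g (p + t *: basis_rV j) <= g p) -> l <= 0.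
Proof.
move=> [d gd ->] gmax; apply: sumr_le0 => j _.
have [g1 [g1P g2P]] := gd j.
apply: (second_derivative_at_max g1P g2P).
by rewrite scale0r addr0; exact: gmax.
Qed.

(** Replaces the coordinate [z_i] by [c + k * z_i].  The maps with [k = 1] and
    [k = -1] send a point of the half-space [z_i >= 0] to two points that are
    mirror images of each other in the hyperplane [z_i = c]. *)
Definition flip (i : 'I_n) (c k : R) p : 'rV[R]_n :=
  p + (c + (k - 1) * p 0 i) *: basis_rV i.

Lemma flip_line i c k p j t :
  flip i c k (p + t *: basis_rV j) =
  flip i c k p + ((if j == i then k else 1) * t) *: basis_rV j.
Proof.
apply/rowP => m; rewrite !mxE eqxx/= [i == j]eq_sym.
by case: (j =P i) => [->|_]; rewrite ?mulr1n ?mulr0n; ring.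
Qed.

Lemma lap_at_flip i c k g p l : k ^+ 2 = 1 ->
  lap_at g (flip i c k p) l -> lap_at (g \o flip i c k) p l.
Proof.
move=> k1 [d gd ->]; exists d => // j.
have [g1 [g1P g2P]] := gd j.
pose s := if j == i then k else 1.
have s1 : s * s = 1 by rewrite /s; case: ifP => _; rewrite ?mulr1 -?expr2.
have ds (t : R) : is_derive t 1 ( *%R s) s.
  have : is_derive t 1 (s \*: (id : R -> R)) (s *: 1) by exact: is_deriveZ.
  by rewrite /GRing.scale/= mulr1.
exists (fun t => g1 (s * t) * s); split => [t|].
  under eq_fun do rewrite /= flip_line.
  exact: (@is_derive1_comp _ (fun t => g (flip i c k p + t *: basis_rV j))).
have -> : (fun t => g1 (s * t) * s) = s \*: (g1 \o *%R s).
  by apply/funext => t /=; rewrite mulrC.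
have -> : d j = s *: (d j * s).
  by rewrite /GRing.scale/= mulrCA s1 mulr1.
by apply: is_deriveZ; apply: is_derive1_comp; rewrite mulr0.
Qed.

Lemma is_C2_lap_at g p : is_Ck 2 g -> lap_at g p (laplacian g p).
Proof.
move=> [_ gC]; exists (fun j => partial j (partial j g) p) => // j.
have [dg [_ /(_ j)[ddg _]]] := gC j.
have line (h : 'rV[R]_n -> R) (hd : forall x, derivable h x (basis_rV j)) t :
    is_derive (t : R) 1 (fun s => h (p + s *: basis_rV j))
      (partial j h (p + t *: basis_rV j)).
  have E : (fun a : R => a^-1 *: (((fun s => h (p + s *: basis_rV j)) \o shift t)
      (a *: 1) - h (p + t *: basis_rV j))) =
    (fun a : R => a^-1 *: ((h \o shift (p + t *: basis_rV j)) (a *: basis_rV j)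
      - h (p + t *: basis_rV j))).
    apply/funext => a /=; congr (_ *: (h _ - _)).
    by rewrite [_%:A]mulr1 scalerDl addrCA.
  by split; rewrite /derivable /derive E//; exact: hd.
exists (fun t => partial j g (p + t *: basis_rV j)); split; first exact: line.
by have := line _ ddg 0; rewrite scale0r addr0.
Qed.

End line_laplacian.

(** * A barrier on half-boxes *)

Section barrier.
Context {R : realType} {n : nat}.
Implicit Types (g : 'rV[R]_n -> R) (x p : 'rV[R]_n) (i j : 'I_n).

Definition normsq x : R := \sum_k x 0 k ^+ 2.

Lemma normsq_ge0 x : 0 <= normsq x.
Proof. by apply: sumr_ge0 => k _; exact: sqr_ge0. Qed.

Lemma ler_normsq x j : x 0 j ^+ 2 <= normsq x.
Proof.
by rewrite /normsq (bigD1 j)//= lerDl sumr_ge0// => k _; exact: sqr_ge0.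
Qed.

Lemma normsq_line x j t :
  normsq (x + t *: basis_rV j) = normsq x + 2 * x 0 j * t + t ^+ 2.
Proof.
rewrite /normsq (bigD1 j)//= [in RHS](bigD1 j)//= !mxE !eqxx/=.
under eq_bigr => k /negbTE kj do rewrite !mxE kj andbF mulr0 addr0.
by ring.
Qed.

Lemma coord_line x j i t :
  (x + t *: basis_rV j) 0 i = x 0 i + t * (i == j)%:R.
Proof. by rewrite !mxE. Qed.

Lemma continuous_coord i : continuous (fun x : 'rV[R]_n => x 0 i).
Proof. exact: coord_continuous. Qed.

Lemma continuous_sum (I : Type) (s : seq I) (F : I -> 'rV[R]_n -> R) :
  (forall k, continuous (F k)) -> continuous (fun x => \sum_(k <- s) F k x).
Proof. by move=> Fc; apply: continuous_big => //; exact: add_continuous. Qed.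

Lemma continuous_add g h : continuous g -> continuous h ->
  continuous (fun x => g x + h x).
Proof. by move=> gc hc x; apply: (@continuousD _ _ _ g h); [exact: gc|exact: hc]. Qed.

Lemma continuous_mul g h : continuous g -> continuous h ->
  continuous (fun x => g x * h x).
Proof. by move=> gc hc x; apply: (@continuousM _ _ g h); [exact: gc|exact: hc]. Qed.

Lemma continuous_const (a : R) : continuous (fun _ : 'rV[R]_n => a).
Proof. exact: cst_continuous. Qed.

Lemma continuous_sqr g : continuous g -> continuous (fun x => g x ^+ 2).
Proof. by move=> gc; exact: continuous_mul. Qed.

Lemma continuous_normsq : continuous normsq.
Proof.
by apply: continuous_sum => k; apply: continuous_sqr; exact: continuous_coord.
Qed.

Lemma second_along_quadratic g j p (a b : R) :
  (forall t, g (p + t *: basis_rV j) = g p + a * t + b * t ^+ 2) ->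
  second_along g j p (2 * b).
Proof.
move=> gE; exists (fun t => a + 2 * b * t); split=> [t|]; last first.
  have -> : (fun t => a + 2 * b * t) = cst a + (2 * b) \*: (id : R -> R) by [].
  apply: (is_derive_eq (is_deriveD (is_derive_cst _ _ _) (is_deriveZ _ (is_derive_id _ _)))).
  by rewrite /GRing.scale/=; ring.
under eq_fun do rewrite gE.
have -> : (fun t => g p + a * t + b * t ^+ 2) =
  (cst (g p) + a \*: (id : R -> R)) + b \*: ((id : R -> R) ^+ 2).
  by apply/funext => s; rewrite !fctE.
apply: is_derive_eq.
by rewrite /GRing.scale/=; ring.
Qed.

(** Strictly superharmonic, nonnegative on the half-box, at least [1] on the part
    of its boundary off the hyperplane [x_i = 0], and of order [1 / L] at a fixed
    point: the coefficient [n.+1] exceeds by one what would make it harmonic. *)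
Definition barrier i (L : R) x : R :=
  L ^- 2 * normsq x + n.+1%:R * (x 0 i / L - (x 0 i / L) ^+ 2).

Lemma lap_at_barrier i L p : lap_at (barrier i L) p (- 2 * L ^- 2).
Proof.
exists (fun j => 2 * (L ^- 2 - n.+1%:R * L ^- 2 * (i == j)%:R)) => [j|].
  apply: (@second_along_quadratic _ _ _
    (L ^- 2 * (2 * p 0 j) + n.+1%:R * (L^-1 - 2 * p 0 i * L ^- 2) * (i == j)%:R)).
  move=> t; rewrite /barrier normsq_line coord_line -exprVn.
  case: (i == j); rewrite ?mulr1n ?mulr0n; ring.
rewrite -mulr_sumr sumrB sumr_const card_ord -mulr_sumr.
rewrite (bigD1 i)//= eqxx big1 => [|j /negbTE]; last by rewrite eq_sym => ->.
by rewrite -[n.+1]addn1 natrD -[L ^- 2 *+ n]mulr_natl mulr1n; ring.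
Qed.

Lemma continuous_barrier i L : continuous (barrier i L).
Proof.
have cL : continuous (fun x : 'rV[R]_n => x 0 i * L^-1).
  by apply: continuous_mul; [exact: continuous_coord|exact: continuous_const].
apply: continuous_add; apply: continuous_mul; try exact: continuous_const.
  exact: continuous_normsq.
apply: continuous_add => // x.
apply: (@continuousN _ _ _ (fun y : 'rV[R]_n => (y 0 i / L) ^+ 2)).
exact: (continuous_sqr cL).
Qed.

Definition half_box i (L : R) : set 'rV[R]_n :=
  [set x | 0 <= x 0 i /\ forall j, - L <= x 0 j <= L].

Lemma compact_half_box i L : compact (half_box i L).
Proof.
rewrite (_ : half_box i L = [set v : 'rV[R]_n |
    forall j, `[(if j == i then Num.max 0 (- L) else - L), L]%classic (v ord0 j)]).
  apply: (rV_compact (A := fun j =>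
    `[(if j == i then Num.max 0 (- L) else - L), L]%classic)) => j.
  exact: segment_compact.
apply/seteqP; split => v /= => [[vi vL] j|vL].
  rewrite in_itv/=; have /andP[v1 v2] := vL j; rewrite v2 andbT.
  by case: eqP => [->|_//]; rewrite ge_max vi; have /andP[->] := vL i.
split.
  by have := vL i; rewrite eqxx in_itv/= ge_max => /andP[/andP[]].
move=> j; have := vL j; rewrite in_itv/= => /andP[+ ->]; rewrite andbT.
by case: eqP => // _; rewrite ge_max => /andP[].
Qed.

Lemma barrier_ge0 i L x : 0 < L -> half_box i L x -> 0 <= barrier i L x.
Proof.
move=> L0 [xi xL]; rewrite /barrier addr_ge0// mulr_ge0//.
- by rewrite invr_ge0 exprn_ge0// ltW.
- exact: normsq_ge0.
have /andP[_ xiL] := xL i.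
have s0 : 0 <= x 0 i / L by rewrite divr_ge0// ltW.
have s1 : x 0 i / L <= 1 by rewrite ler_pdivrMr ?mul1r.
by nra.
Qed.

Lemma barrier_ge1 i L x j : 0 < L -> half_box i L x -> x 0 j ^+ 2 = L ^+ 2 ->
  1 <= barrier i L x.
Proof.
move=> L0 [xi xL] xj; rewrite /barrier.
have /andP[_ xiL] := xL i.
have s0 : 0 <= x 0 i / L by rewrite divr_ge0// ltW.
have s1 : x 0 i / L <= 1 by rewrite ler_pdivrMr ?mul1r.
rewrite -[leLHS]addr0 lerD//; last by rewrite mulr_ge0//; nra.
by rewrite mulrC ler_pdivlMr ?exprn_gt0// mul1r -xj ler_normsq.
Qed.

(** The maximum principle for [g - M * barrier i L]: this function is nonpositive
    on the boundary of the half-box, and at an interior maximum its Laplacian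
    would be nonpositive, while it is at least [2 * M / L ^ 2]. *)
Lemma half_box_comparison i L M g : 0 < L -> 0 < M -> continuous g ->
  (forall x, half_box i L x -> exists2 l, 0 <= l & lap_at g x l) ->
  (forall x, half_box i L x -> g x <= M) ->
  (forall x, half_box i L x -> x 0 i = 0 -> g x <= 0) ->
  forall x, half_box i L x -> g x <= M * barrier i L x.
Proof.
move=> L0 M0 gc gl gM g0 x Kx.
pose F y := g y + (- M) * barrier i L y.
have Fc : continuous F.
  apply: continuous_add => //; apply: continuous_mul.
    exact: continuous_const.
  exact: continuous_barrier.
(* The maximum is attained; a positive one excludes every boundary face. *)
have [z Kz zmax] := @EVT_max_rV R n F (half_box i L) (ex_intro _ x Kx)
  (@compact_half_box i L) (continuous_subspaceT Fc).
rewrite inE in Kz.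
suff Fz : F z <= 0.
  have := zmax x; rewrite inE => /(_ Kx); rewrite /F in Fz *; lra.
rewrite leNgt; apply/negP => Fz.
have bL j : z 0 j ^+ 2 != L ^+ 2.
  apply/eqP => /(barrier_ge1 L0 Kz) b1; have := gM _ Kz.
  by rewrite /F in Fz; nra.
have zi : z 0 i != 0.
  apply/eqP => /(g0 _ Kz); have := barrier_ge0 L0 Kz.
  by rewrite /F in Fz; nra.
have [l l0 lg] := gl _ Kz.
have := lap_at_max (lap_atD lg (lap_atZ (- M) (lap_at_barrier i L z))) _.
move=> /(_ _)/wrap[j|].
  have [z0 zL] := Kz.
  have /andP[zjl zjr] := zL j.
  have zjl' : - L < z 0 j.
    by rewrite lt_neqAle zjl andbT; apply: contra_neq (bL j) => <-; rewrite sqrrN.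
  have zjr' : z 0 j < L.
    by rewrite lt_neqAle zjr andbT; apply: contra_neq (bL j) => ->.
  have zi0 : 0 < z 0 i by rewrite lt_neqAle eq_sym zi.
  pose e := Num.min (z 0 i) (Num.min (z 0 j + L) (L - z 0 j)).
  have e0 : 0 < e by rewrite !lt_min zi0; lra.
  have [ei [el er]] : e <= z 0 i /\ e <= z 0 j + L /\ e <= L - z 0 j.
    by rewrite !ge_min !lexx !orbT.
  exists e => // t; rewrite /= sub0r normrN ltr_norml => te.
  apply: zmax; rewrite inE; split=> [|k]; rewrite coord_line.
    case: eqP => [ij|_]; last by rewrite mulr0 addr0.
    by rewrite mulr1; lra.
  case: eqP => [->|_]; last by rewrite mulr0 addr0.
  by rewrite mulr1; lra.
have L2 : 0 < L ^- 2 by rewrite invr_gt0 exprn_gt0.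
by nra.
Qed.

End barrier.

(** * Comparison of mirror images *)

Section reflection.
Context {R : realType} {n : nat}.
Implicit Types (u W : 'rV[R]_n -> R) (x y p : 'rV[R]_n) (i j : 'I_n).

Lemma continuous_flip i (c k : R) : continuous (flip i c k : 'rV[R]_n -> 'rV[R]_n).
Proof.
have cc : continuous (fun p : 'rV[R]_n => c + (k - 1) * p 0 i).
  apply: continuous_add; first exact: continuous_const.
  by apply: continuous_mul; [exact: continuous_const|exact: continuous_coord].
move=> p; apply: (@continuousD _ _ _ id
  (fun p : 'rV[R]_n => (c + (k - 1) * p 0 i) *: basis_rV i)) => //.
apply: (@continuousZ _ _ _ (fun p : 'rV[R]_n => c + (k - 1) * p 0 i)
  (cst (basis_rV i)) p); [exact: cc|exact: cst_continuous].
Qed.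

Lemma flip_coord i c k p j :
  flip i c k p 0 j = if j == i then c + k * p 0 i else p 0 j.
Proof.
rewrite !mxE eqxx/=; case: eqP => [->|_]; rewrite ?mulr1n ?mulr0n; ring.
Qed.

Lemma barrier_le i (L : R) x : 1 <= L -> half_box i L x ->
  barrier i L x <= (normsq x + n.+1%:R * x 0 i) / L.
Proof.
move=> L1 [xi xL]; have L0 : 0 < L by lra.
have Li : 0 < L^-1 by rewrite invr_gt0.
have Li1 : L^-1 <= 1 by rewrite invf_le1.
have := normsq_ge0 x; have := ler0n R n.+1.
have := sqr_ge0 (x 0 i / L).
rewrite /barrier -exprVn mulrDl -[n.+1%:R * _ / L]mulrA; move: L^-1 Li Li1 => l l0 l1.
move: (normsq x) n.+1%:R (x 0 i * l) => q m s s2 m0 q0.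
rewrite lerD//.
  by rewrite mulrC ler_wpM2l// expr2 ger_pMl.
by rewrite ler_wpM2l//; lra.
Qed.

(** The points [x] and [y] are mirror images in the hyperplane half-way between
    them, and [u z - (u + W) (mirror of z)] is nonpositive on that hyperplane.
    The half-box comparison bounds it at [x] by a multiple of [1 / L], and [L] is
    arbitrary.  The function [W] may depend on the size of the box because only
    the bound [A] on [W y] enters the conclusion. *)
Lemma reflection_comparison u (lu : 'rV[R]_n -> R) (M A : R) x y i :
  continuous u -> (forall p, lap_at u p (lu p)) -> (forall p, 0 <= lu p) ->
  (forall p, 0 < u p <= M) ->
  (forall N : R, exists W, [/\ continuous W, forall p, 0 <= W p, W y <= A &
    forall p, (forall j, `|p 0 j| <= N) ->
      exists2 k, lap_at W p k & lu p + k <= 0]) ->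
  (forall j, j != i -> x 0 j = y 0 j) ->
  u x <= u y + A.
Proof.
move=> uc lul lu0 uM WE xy; rewrite -subr_le0 leNgt; apply/negP => d0.
set d := u x - (u y + A) in d0.
have M0 : 0 < M by have /andP[u0 ?] := uM x; exact: lt_le_trans u0 _.
pose c := (x 0 i + y 0 i) / 2.
pose k : R := if y 0 i <= x 0 i then 1 else -1.
have k2 : k ^+ 2 = 1 by rewrite /k; case: ifP => _; rewrite ?sqrrN expr1n.
have nk2 : (- k) ^+ 2 = 1 by rewrite sqrrN.
pose s := `|x 0 i - y 0 i| / 2.
have s0 : 0 <= s by rewrite divr_ge0.
have ks : k * s = (x 0 i - y 0 i) / 2.
  rewrite /k /s; case: leP => h.
    by rewrite ger0_norm ?subr_ge0// mul1r.
  by rewrite ltr0_norm ?subr_lt0//; ring.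
pose z : 'rV[R]_n := \row_j (if j == i then s else x 0 j).
have zi : z 0 i = s by rewrite mxE eqxx.
have zx : flip i c k z = x.
  apply/rowP => j; rewrite flip_coord zi mxE ks; case: eqP => [->|//].
  by rewrite /c; field.
have zy : flip i c (- k) z = y.
  apply/rowP => j; rewrite flip_coord zi mxE mulNr ks.
  by case: eqP => [->|/eqP/xy//]; rewrite /c; field.
pose B := M * (normsq z + n.+1%:R * s).
have B0 : 0 <= B.
  by rewrite mulr_ge0 ?(ltW M0)// addr_ge0 ?normsq_ge0// mulr_ge0.
(* The last term makes the error [B / L] smaller than the assumed excess [d]. *)
pose L := 1 + s + \sum_j `|x 0 j| + B / d.
have S0 : 0 <= \sum_j `|x 0 j| by apply: sumr_ge0.
have Bd0 : 0 <= B / d by rewrite divr_ge0// ltW.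
have L1 : 1 <= L by rewrite /L; lra.
have L0 : 0 < L by lra.
have Kz : half_box i L z.
  split=> [|j]; first by rewrite zi.
  rewrite -ler_norml mxE; case: eqP => _; first by rewrite ger0_norm// /L; lra.
  have : `|x 0 j| <= \sum_j `|x 0 j|.
    by rewrite (bigD1 j)//= lerDl sumr_ge0.
  by rewrite /L; lra.
have [W [Wc W0 Wy WL]] := WE (L + `|c|).
pose G p := u (flip i c k p) + (-1) * (u (flip i c (- k) p) + W (flip i c (- k) p)).
have : G z <= M * barrier i L z.
  apply: half_box_comparison Kz => //.
  - have cf (g : 'rV[R]_n -> R) (h : R) : continuous g -> continuous (fun p => g (flip i c h p)).
      move=> gc p; apply: (@continuous_comp _ _ _ (flip i c h) g).
        exact: continuous_flip.
      exact: gc.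
    apply: continuous_add; first exact: cf.
    apply: continuous_mul; first exact: continuous_const.
    by apply: continuous_add; exact: cf.
  - move=> p [pi pL].
    have [j|m Wm hm] := WL (flip i c (- k) p).
      rewrite flip_coord; have /andP[? ?] := pL j.
      case: eqP => _; last first.
        by rewrite (@le_trans _ _ L) ?lerDl// ler_norml pL.
      rewrite addrC (le_trans (ler_normD _ _))// lerD2r normrM.
      have -> : `|- k| = 1.
        by rewrite normrN /k; case: ifP => _; rewrite ?normrN normr1.
      by rewrite mul1r ler_norml pL.
    exists (lu (flip i c k p) + -1 * (lu (flip i c (- k) p) + m)).
      by have := lu0 (flip i c k p); lra.
    apply: (lap_atD (lap_at_flip k2 (lul _))); apply: lap_atZ.
    exact: lap_atD (lap_at_flip nk2 (lul _)) (lap_at_flip nk2 Wm).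
  - move=> p _; rewrite /G.
    have /andP[_ ?] := uM (flip i c k p).
    have /andP[? _] := uM (flip i c (- k) p).
    have := W0 (flip i c (- k) p); lra.
  - move=> p _ pi; have -> : G p = - W (flip i c (- k) p); last by rewrite oppr_le0.
    rewrite /G (_ : flip i c k p = flip i c (- k) p); first by ring.
    by rewrite /flip pi !mulr0.
have /(ler_wpM2l (ltW M0)) := barrier_le L1 Kz.
rewrite zi mulrA -/B /G zx zy => b1 b2.
have : d <= B / L by move: b1 b2; rewrite /d; lra.
rewrite ler_pdivlMr// mulrC -ler_pdivlMr//.
by rewrite /L; lra.
Qed.

End reflection.

(** * Lower sums for the Lebesgue measure on tuples *)

Section lower_sums.
Context {R : realType}.

Definition box n (A : 'I_n -> set R) : set (n.-tuple (measurableTypeR R)) :=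
  [set t | forall i, A i (tnth t i)].

Lemma measurable_box n (A : 'I_n -> set (measurableTypeR R)) :
  (forall i, measurable (A i)) -> measurable (box A).
Proof.
move=> mA; have -> : box A = \bigcap_(i in [set: 'I_n]) ((@tnth n _)^~ i @^-1` A i).
  by apply/seteqP; split => t /= tA i => [_|]; exact: tA.
apply: fin_bigcap_measurable => // i _.
by rewrite -[X in measurable X]setTI; exact: measurable_tnth.
Qed.

(** The recursive definition of [lebesgue_tuple] splits off the first coordinate
    of a box. *)
Lemma lebesgue_tuple_box n (A : 'I_n -> set (measurableTypeR R)) (l : 'I_n -> R) :
  (forall i, measurable (A i)) ->
  (forall i, lebesgue_measure (A i) = (l i)%:E) ->
  @lebesgue_tuple R n (box A) = (\prod_i l i)%:E.
Proof.
elim: n A l => [|n IH] A l mA lA.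
  by rewrite big_ord0 /= diracE mem_set// => -[].
have E : @tuple_cons R n @^-1` box A = A ord0 `*` box (fun i => A (lift ord0 i)).
  apply/seteqP; split => [[a t] /= h|[a t] /= [h0 ht] i].
    by split=> [|i]; [have := h ord0|have := h (lift ord0 i)]; rewrite ?tnth0 ?tnthS.
  case: (unliftP ord0 i) => [j ->|->]; last by rewrite /tuple_cons tnth0.
  by rewrite /tuple_cons tnthS; exact: ht.
rewrite /= /lebesgue_tuple_step /pushforward E product_measure1E//; last first.
  by apply: measurable_box => i; exact: mA.
rewrite (IH _ (fun i => l (lift ord0 i)))// big_ord_recl EFinM.
by congr (_ * _)%E; exact: lA.
Qed.

(** The integral of a nonnegative function is the supremum of the integrals of the
    simple functions below it, so monotonicity asks for no measurability. *)
Lemma ge0_le_integral_nonmeasurable d (T : measurableType d)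
    (mu : {measure set T -> \bar R}) (g h : T -> \bar R) :
  (forall x, 0 <= g x)%E -> (forall x, g x <= h x)%E ->
  (\int[mu]_x g x <= \int[mu]_x h x)%E.
Proof.
move=> g0 gh; have h0 x : (0 <= h x)%E by apply: le_trans (gh x).
rewrite !ge0_integralTE//; apply: le_ereal_sup => _ [f fg <-]; exists f => // x.
exact: le_trans (fg x) (gh x).
Qed.

Lemma lower_sum_le_integral d (T : measurableType d)
    (mu : {measure set T -> \bar R}) (I : finType) (Q : I -> set T)
    (c m : I -> R) (h : T -> R) :
  (forall k, measurable (Q k)) -> (forall k, mu (Q k) = (m k)%:E) ->
  trivIset setT Q -> (forall k, 0 <= c k) -> (forall x, 0 <= h x) ->
  (forall k x, Q k x -> c k <= h x) ->
  ((\sum_k c k * m k)%:E <= \int[mu]_x (h x)%:E)%E.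
Proof.
move=> mQ mE tQ c0 h0 ch.
pose g x : \bar R := (\sum_(k : I) (c k * \1_(Q k) x)%:E)%E.
have gE : (\int[mu]_x g x = (\sum_k c k * m k)%:E)%E.
  rewrite ge0_integral_sum//; last 2 first.
  - move=> k; apply/measurable_EFinP; apply: measurable_funM => //.
  - by move=> k x _; rewrite lee_fin mulr_ge0.
  rewrite -sumEFin; apply: eq_bigr => k _.
  rewrite (integralZl_indic _ (fun=> Q k))//; last by rewrite ltNge c0.
  by rewrite integral_indic// setIT mE EFinM.
rewrite -gE; apply: ge0_le_integral_nonmeasurable => x.
  by apply: sume_ge0 => k _; rewrite lee_fin mulr_ge0.
rewrite /g sumEFin lee_fin.
have [[k Qk]|noQ] := pselect (exists k, Q k x); last first.
  rewrite big1// => k _; rewrite indicE memNset ?mulr0// => Qk.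
  by apply: noQ; exists k.
rewrite (bigD1 k)//= big1 ?addr0.
  by rewrite indicE mem_set// mulr1 ch.
move=> j jk; rewrite indicE memNset ?mulr0// => Qj.
by move/eqP: jk; apply; apply: tQ => //; exists x.
Qed.

End lower_sums.

(** * A smooth substitute for the Newtonian potential *)

Section discrete_potential.
Context {R : realType} {n : nat}.
Implicit Types (x y z p : 'rV[R]_n).

Local Notation alpha := (n%:R / 2 - 1 : R).

(** The Newtonian kernel [|x - y|^(2 - n)] with its singularity smoothed out at
    the length [sqrt a] (the Plummer potential).  It is superharmonic, its
    Laplacian being concentrated near [y]. *)
Definition plummer (a : R) y x : R := (a + normsq (x - y)) `^ (- alpha).

Lemma plummer_ge0 a y x : 0 <= plummer a y x.
Proof. exact: powR_ge0. Qed.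

Lemma is_derive_powR_comp (b : R) (q : R -> R) (t dq : R) :
  0 < q t -> is_derive t 1 q dq ->
  is_derive t 1 (fun s => q s `^ b) (b * q t `^ (b - 1) * dq).
Proof.
move=> qt dqt.
exact: (@is_derive1_comp _ (fun s => s `^ b) q t _ _ (is_derive1_powR b qt) dqt).
Qed.

Lemma lap_at_plummer (a : R) y p : 0 < a ->
  lap_at (plummer a y) p
    (- (n%:R * (n%:R - 2) * a * (a + normsq (p - y)) `^ (- alpha - 2))).
Proof.
move=> a0; set q0 := a + normsq (p - y).
have q_gt0 x : 0 < a + normsq (x - y).
  by rewrite ltr_wpDr// normsq_ge0.
have q0_gt0 : 0 < q0 by exact: q_gt0.
pose z := p - y.
exists (fun j => 4 * alpha * (alpha + 1) * q0 `^ (- alpha - 2) * (z 0 j) ^+ 2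
               - 2 * alpha * q0 `^ (- alpha - 1)) => [j|]; last first.
  rewrite sumrB -mulr_sumr -/(normsq z) sumr_const card_ord -[X in _ - X]mulr_natl.
  have -> : q0 `^ (- alpha - 1) = q0 * q0 `^ (- alpha - 2).
    rewrite -{2}[q0]powRr1 ?ltW// -powRD; first by congr (_ `^ _); ring.
    by apply/implyP => _; rewrite gt_eqF.
  move: (q0 `^ (- alpha - 2)) => P; rewrite /q0 -/z; move: (normsq z) => r.
  by field.
pose q (t : R) := q0 + 2 * z 0 j * t + t ^+ 2.
have qE t : a + normsq (p + t *: basis_rV j - y) = q t.
  by rewrite addrAC normsq_line /q /q0 !addrA.
have q0t t : 0 < q t by rewrite -qE.
have dq (t : R) : is_derive t 1 q (2 * z 0 j + 2 * t).
  have -> : q = (cst q0 + (2 * z 0 j) \*: (id : R -> R)) + (id : R -> R) ^+ 2.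
    by apply/funext => s; rewrite !fctE.
  by apply: is_derive_eq; rewrite /GRing.scale/=; ring.
exists (fun t => (- alpha * q t `^ (- alpha - 1)) * (2 * z 0 j + 2 * t)).
split=> [t|].
  under eq_fun do rewrite /plummer qE.
  exact: is_derive_powR_comp.
have d1 : is_derive (0 : R) 1 (fun t => q t `^ (- alpha - 1))
    ((- alpha - 1) * q 0 `^ (- alpha - 1 - 1) * (2 * z 0 j + 2 * 0)).
  exact: is_derive_powR_comp.
have d2 : is_derive (0 : R) 1 (fun t => 2 * z 0 j + 2 * t) 2.
  have -> : (fun t => 2 * z 0 j + 2 * t) = cst (2 * z 0 j) + 2 \*: (id : R -> R) by [].
  by apply: is_derive_eq; rewrite /GRing.scale/=; ring.
have -> : (fun t => - alpha * q t `^ (- alpha - 1) * (2 * z 0 j + 2 * t)) =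
  ((- alpha) \*: (fun t => q t `^ (- alpha - 1))) * (fun t => 2 * z 0 j + 2 * t).
  by apply/funext => t.
apply: is_derive_eq.
have q00 : q 0 = q0 by rewrite /q; ring.
rewrite q00.
have -> : - alpha - 1 - 1 = - alpha - 2 by ring.
rewrite /GRing.scale/= q00 -[X in X * 2]/(- alpha * q0 `^ (- alpha - 1)).
by ring.
Qed.

Lemma continuous_plummer (a : R) y : 0 < a -> continuous (plummer a y).
Proof.
move=> a0 x.
have c1 : continuous (fun x => a + normsq (x - y)).
  apply: continuous_add; first exact: continuous_const.
  move=> p; apply: (@continuous_comp _ _ _ (fun p => p - y) normsq).
    by apply: (@continuousB _ _ _ id (cst y)); [exact: cvg_id|exact: cst_continuous].
  exact: continuous_normsq.
apply: (@continuous_comp _ _ _ (fun x => a + normsq (x - y)) (fun s => s `^ (- alpha))).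
  exact: c1.
apply/differentiable_continuous/derivable1_diffP.
have q_gt0 : 0 < a + normsq (x - y) by rewrite ltr_wpDr// normsq_ge0.
by have [] := is_derive1_powR (- alpha) q_gt0.
Qed.

(** Compactness: nearby values of a positive continuous function on a box have
    ratio at most [2], at a scale uniform over the box. *)
Lemma positive_comparable_nearby (rho : 'rV[R]_n -> R) (N : R) :
  continuous rho -> (forall x, 0 < rho x) ->
  exists m : nat, forall x y, (forall j, `|x 0 j| <= N) ->
    (forall j, `|x 0 j - y 0 j| <= m.+1%:R^-1) ->
    rho x <= 2 * rho y /\ rho y <= 2 * rho x.
Proof.
move=> rhoc rho0.
pose K : set 'rV[R]_n := [set v | forall j, `[- N, N]%classic (v ord0 j)].
have cK : compact K.
  by apply: (rV_compact (A := fun=> `[- N, N]%classic)) => _; exact: segment_compact.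
pose P (m : nat) x := forall y, (forall j, `|x 0 j - y 0 j| <= m.+1%:R^-1) ->
    rho x <= 2 * rho y /\ rho y <= 2 * rho x.
have /compact_near_coveringP cov := cK.
(* Near [x], values within [rho x / 3] of [rho x] have ratio at most [2]. *)
have [|m _ Pm] := @cov nat \oo P _.
  move=> x Kx; have r3 : 0 < rho x / 3 by rewrite divr_gt0.
  have /cvgrPdist_lt/(_ _ r3)/nbhs_ballP[d /= d0 xd] := rhoc x.
  pose M := Num.truncn (2 / d).
  exists (ball x (d / 2), [set m | (M <= m)%N]).
    by split; [apply: nbhsx_ballx; rewrite divr_gt0|exists M].
  - move=> [x' m] [/= [_ xx'] Mm] y x'y.
    have md : m.+1%:R^-1 < d / 2 :> R.
      rewrite invf_plt ?posrE ?divr_gt0//= invf_div.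
      by apply: (lt_le_trans (truncnS_gt _)); rewrite ler_nat.
    have h1 : `|rho x - rho x'| < rho x / 3.
      apply: xd; split=> // k j; apply: lt_trans (xx' k j) _.
      by lra.
    have h2 : `|rho x - rho y| < rho x / 3.
      apply: xd; split=> // k j; rewrite (ord1 k).
      have a := x'y j; have b : `|x 0 j - x' 0 j| < d / 2 := xx' 0 j.
      rewrite /ball/= (_ : _ - _ = (x 0 j - x' 0 j) + (x' 0 j - y 0 j)); last by ring.
      apply: (le_lt_trans (ler_normD _ _)).
      by rewrite [ltRHS]splitr ltrD// (le_lt_trans a).
    by move: h1 h2; rewrite !ltr_norml; lra.
exists m => x y xN xy; apply: (Pm m) => //= j.
by rewrite /= in_itv/= -ler_norml.
Qed.

Lemma ge3_natr : (3 <= n)%N -> 3 <= n%:R :> R.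
Proof. by move=> n3; rewrite (ler_nat R 3 n). Qed.

Lemma enorm_powR x : enorm x ^ (2 - n%:Z) = normsq x `^ (- alpha).
Proof.
rewrite /enorm -/(normsq x) -powR_intmul ?sqrtr_ge0// -powR12_sqrt ?normsq_ge0//.
rewrite -powRrM; congr (_ `^ _).
have -> : (2 - n%:Z)%:~R = 2 - n%:R :> R by rewrite intrB.
by field.
Qed.

(** When [z] is within [e] of [y] in each coordinate, [|x - z|^2] is at most twice
    [n * e^2 + |x - y|^2].  The point [z = x] is excluded because the value of
    [0] to a negative power is [0] there. *)
Lemma plummer_le_newton (n3 : (3 <= n)%N) (e : R) x y z :
  (forall j, `|z 0 j - y 0 j| <= e) -> x != z ->
  plummer (n%:R * e ^+ 2) y x <= 2 `^ alpha * enorm (x - z) ^ (2 - n%:Z).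
Proof.
move=> zy xz; rewrite enorm_powR /plummer !powRN.
set q := _ + normsq _; set s := normsq (x - z).
have alpha0 : 0 <= alpha by have := ge3_natr n3; lra.
have s0 : 0 < s.
  have [j xzj] : exists j, x 0 j != z 0 j.
    apply/existsP; apply: contraR xz => /existsPn h; apply/eqP/rowP => j.
    by apply/eqP; have := h j; rewrite negbK.
  apply: lt_le_trans (ler_normsq _ j).
  by rewrite !mxE exprn_even_gt0//= subr_eq0.
have sq : s <= 2 * q.
  have -> : 2 * q = \sum_(j < n) (2 * e ^+ 2 + 2 * (x - y) 0 j ^+ 2).
    rewrite /q /normsq big_split /= sumr_const card_ord -mulr_sumr.
    by rewrite -[X in _ = X + _]mulr_natl; ring.
  apply: ler_sum => j _; rewrite !mxE; have := zy j; rewrite ler_norml.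
  move: (x 0 j) (y 0 j) (z 0 j) => a b c /andP[h1 h2].
  have : (c - b) ^+ 2 <= e ^+ 2 by nra.
  have := sqr_ge0 (a - b + (c - b)); lra.
have q0 : 0 < q by lra.
have h : s `^ alpha <= 2 `^ alpha * q `^ alpha.
  rewrite -powRM ?(ltW q0)//.
  by apply: (ge0_ler_powR alpha0 _ _ sq); rewrite nnegrE ?mulr_ge0 ?ltW.
by rewrite ler_pdivlMr ?powR_gt0// mulrC ler_pdivrMr ?powR_gt0.
Qed.

(** A lower bound, free of the mesh size, for minus the Laplacian at [x] of the
    smoothed potential of a unit density on the cube that contains [x]. *)
Definition mesh_constant : R :=
  n%:R * (n%:R - 2) * n%:R * (2 * n%:R) `^ (- alpha - 2).

Lemma mesh_constant_gt0 : (3 <= n)%N -> 0 < mesh_constant.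
Proof.
move=> /ge3_natr h.
by rewrite !mulr_gt0 ?powR_gt0//; lra.
Qed.

(** The powers of [e] cancel: smoothing at length [sqrt n * e] a mass [e ^ n] keeps
    the density of the smeared mass of order one. *)
Lemma lap_plummer_mesh (n3 : (3 <= n)%N) (e : R) x y : 0 < e -> (forall j, `|x 0 j - y 0 j| <= e) ->
  mesh_constant <= e ^+ n * (n%:R * (n%:R - 2) * (n%:R * e ^+ 2) *
    (n%:R * e ^+ 2 + normsq (x - y)) `^ (- alpha - 2)).
Proof.
move=> e0 xy; have n0 := ge3_natr n3; set q := _ + normsq _.
have q0 : 0 < q.
  by rewrite ltr_wpDr ?normsq_ge0// mulr_gt0 ?exprn_gt0//; lra.
have qe : q <= 2 * n%:R * e ^+ 2.
  have : normsq (x - y) <= \sum_(j < n) e ^+ 2.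
    apply: ler_sum => j _; rewrite !mxE; have := xy j; rewrite ler_norml.
    by move: (x 0 j - y 0 j) => a /andP[? ?]; nra.
  by rewrite sumr_const card_ord -[X in _ <= X]mulr_natl /q; lra.
have b0 : 0 <= alpha + 2 by lra.
have q1 : q `^ (alpha + 2) <= (2 * n%:R * e ^+ 2) `^ (alpha + 2).
  by apply: (ge0_ler_powR b0 _ _ qe); rewrite nnegrE ?(ltW q0)// (le_trans (ltW q0)).
have -> : - alpha - 2 = - (alpha + 2) by ring.
have e2 : (e ^+ 2) `^ (alpha + 2) = e ^+ n * e ^+ 2.
  rewrite -exprD -!powR_mulrn ?ltW// -powRrM natrD; congr (_ `^ _).
  by field.
have -> : mesh_constant = e ^+ n * (n%:R * (n%:R - 2) * (n%:R * e ^+ 2) *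
    (2 * n%:R * e ^+ 2) `^ (- (alpha + 2))).
  rewrite /mesh_constant (_ : - alpha - 2 = - (alpha + 2)); last by ring.
  rewrite !powRN [(2 * n%:R * e ^+ 2) `^ _]powRM ?sqr_ge0 ?mulr_ge0// e2.
  have : 0 < (2 * n%:R : R) `^ (alpha + 2) by rewrite powR_gt0//; lra.
  have : 0 < e ^+ n by rewrite exprn_gt0.
  move: (_ `^ _) (e ^+ n) => P E E0 P0; field.
  by rewrite !gt_eqF.
rewrite ler_wpM2l ?exprn_ge0 ?(ltW e0)// ler_wpM2l//.
  by rewrite !mulr_ge0 ?exprn_ge0 ?(ltW e0)//; lra.
rewrite !powRN lef_pV2 ?posrE ?powR_gt0//.
by rewrite (lt_le_trans q0).
Qed.

Definition cell (N : nat) (e : R) (k : nat) : set R :=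
  `[- N%:R + k%:R * e, - N%:R + k.+1%:R * e[%classic.

Lemma cell_dist N e k (s : R) : cell N e k s -> `|s - (- N%:R + k%:R * e)| <= e.
Proof.
rewrite /cell/= in_itv/= -[k.+1]addn1 natrD => /andP[s1 s2].
by rewrite ler_norml; move: k%:R s1 s2 => K s1 s2; lra.
Qed.

Lemma cell_inj N e k l (s : R) : 0 < e -> cell N e k s -> cell N e l s -> k = l.
Proof.
move=> e0; rewrite /cell/= !in_itv/= => /andP[k1 k2] /andP[l1 l2].
have h1 := le_lt_trans k1 l2; have h2 := le_lt_trans l1 k2.
move: h1 h2; rewrite !ltrD2l !ltr_pM2r// !ltr_nat => h1 h2.
by apply/eqP; rewrite eqn_leq -ltnS h1 -ltnS h2.
Qed.

Lemma cell_ex N m (s : R) : `|s| < N%:R ->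
  exists k : 'I_(2 * N * m.+1), cell N m.+1%:R^-1 k s.
Proof.
rewrite ltr_norml => /andP[s1 s2].
have m0 : 0 < m.+1%:R :> R by rewrite ltr0n.
pose t := (s + N%:R) * m.+1%:R.
have t0 : 0 <= t by rewrite mulr_ge0//; lra.
have tK : (Num.truncn t < 2 * N * m.+1)%N.
  by rewrite truncn_lt_nat// !natrM ltr_pM2r//; lra.
exists (Ordinal tK); rewrite /cell/= in_itv/=.
have /andP[t1 t2] := truncn_itv t0.
rewrite -lerBrDl -ltrBlDl opprK ler_pdivrMr// ltr_pdivlMr//.
by rewrite -/t t1 t2.
Qed.

Lemma lebesgue_measure_cell N e k (a : R) : 0 < e ->
  lebesgue_measure (cell N e k `\ a) = e%:E.
Proof.
move=> e0; have mc : measurable (cell N e k) by exact: measurable_itv.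
have cE : lebesgue_measure (cell N e k) = e%:E.
  rewrite /cell lebesgue_measure_itv/= lte_fin ltrD2l ltr_pM2r// ltr_nat ltnSn.
  by rewrite -EFinD -[k.+1]addn1 natrD; congr (_%:E); ring.
rewrite measureD//; last first.
  by rewrite [X in (X < _)%E](_ : _ = e%:E) ?ltry//; exact: cE.
rewrite [X in (_ - X)%E](_ : _ = 0%E) ?sube0; first exact: cE.
apply/eqP; rewrite -measure_le0 -(lebesgue_measure_set1 a).
by apply: le_measure; rewrite ?inE//; exact: measurableI.
Qed.

(** [W] is the normalised sum over the cubes [k] of [e ^ n * rho (node k)] times
    the smoothed kernel centred at [node k].  The constant [C] is the same for
    all boxes because both bounds, [mesh_constant] from below on the Laplacian
    and [B] from above on the masses and kernels, are independent of the mesh. *)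
Lemma discrete_potential (n3 : (3 <= n)%N) (rho : 'rV[R]_n -> R) :
  continuous rho -> (forall x, 0 < rho x) ->
  exists2 C : R, 0 < C & forall N : R, exists W : 'rV[R]_n -> R,
    [/\ continuous W, forall p, 0 <= W p,
        forall y, ((W y)%:E <= C%:E * newton_integral rho y)%E &
        forall p, (forall j, `|p 0 j| <= N) ->
          exists2 l, lap_at W p l & rho p + l <= 0].
Proof.
move=> rhoc rho0; have n0 := ge3_natr n3.
pose c := mesh_constant; have c0 : 0 < c by exact: mesh_constant_gt0 n3.
(* [2] from comparing values of [rho], [2 `^ alpha] from comparing kernels. *)
pose B : R := 2 * 2 `^ alpha; have B0 : 0 < B by rewrite mulr_gt0 ?powR_gt0.
exists (2 / c * B) => [|N]; first by rewrite mulr_gt0 ?divr_gt0.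
pose Nn := (Num.truncn `|N|).+1.
have NNn : `|N| < Nn%:R by exact: truncnS_gt.
have [m rhom] := positive_comparable_nearby Nn%:R rhoc rho0.
pose e : R := m.+1%:R^-1; have e0 : 0 < e by rewrite invr_gt0 ltr0n.
pose K := {ffun 'I_n -> 'I_(2 * Nn * m.+1)}.
pose node (k : K) : 'rV[R]_n := \row_j (- Nn%:R + (k j)%:R * e).
have nodeN (k : K) j : `|node k 0 j| <= Nn%:R.
  rewrite mxE ler_norml lerDl mulr_ge0 ?ler0n ?(ltW e0)//= addrC lerBlDr.
  rewrite /e ler_pdivrMr ?ltr0n// -natrD -natrM ler_nat.
  by have := ltn_ord (k j); lia.
have a0 : 0 < n%:R * e ^+ 2 by rewrite mulr_gt0 ?exprn_gt0//; lra.
pose G (k : K) x := e ^+ n * rho (node k) * plummer (n%:R * e ^+ 2) (node k) x.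
have G0 k x : 0 <= G k x.
  by rewrite !mulr_ge0 ?exprn_ge0 ?(ltW e0) ?(ltW (rho0 _)) ?plummer_ge0.
exists (fun x => 2 / c * \sum_k G k x); split.
- apply: continuous_mul; first exact: continuous_const.
  apply: continuous_sum => k; apply: continuous_mul; first exact: continuous_const.
  exact: continuous_plummer.
- by move=> p; rewrite mulr_ge0 ?divr_ge0 ?(ltW c0)// sumr_ge0.
- move=> y.
  (* Removing the coordinates of [y] keeps the volume and avoids the singularity. *)
  pose Q (k : K) := box (fun j => cell Nn e (k j) `\ y 0 j).
  pose d (k : K) := rho (node k) * plummer (n%:R * e ^+ 2) (node k) y / B.
  have -> : 2 / c * \sum_k G k y = (2 / c * B) * \sum_k d k * e ^+ n.
    rewrite -[RHS]mulrA; congr (_ * _); rewrite mulr_sumr; apply: eq_bigr => k _.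
    by rewrite /G /d; field; rewrite gt_eqF.
  rewrite EFinM lee_pmul2l ?lte_fin ?mulr_gt0 ?invr_gt0//.
  apply: (lower_sum_le_integral (Q := Q)).
  + move=> k; apply: measurable_box => j; apply: measurableD => //.
    exact: measurable_itv.
  + move=> k; rewrite (_ : e ^+ n = \prod_(j < n) e); last first.
      by rewrite prodr_const card_ord.
    apply: lebesgue_tuple_box.
    * by move=> j; apply: measurableD => //; exact: measurable_itv.
    * by move=> j; exact: lebesgue_measure_cell.
  + move=> k l _ _ [t [kt lt]]; apply/ffunP => j; apply/val_inj => /=.
    by apply: (cell_inj e0) (kt j).1 (lt j).1.
  + by move=> k; rewrite divr_ge0 ?(ltW B0)// mulr_ge0 ?plummer_ge0// ltW.
  + by move=> t; rewrite mulr_ge0 ?(ltW (rho0 _))// enorm_powR powR_ge0.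
  + move=> k t kt.
    have tk j : `|rowt t 0 j - node k 0 j| <= e.
      by rewrite !mxE; exact: cell_dist (kt j).1.
    have yt : y != rowt t.
      apply/eqP => yt; pose j0 := Ordinal (ltn_trans (isT : (0 < 2)%N) n3).
      by have [_] := kt j0; apply; rewrite /= yt mxE.
    have h1 := plummer_le_newton n3 tk yt.
    have [h2 _] : rho (node k) <= 2 * rho (rowt t) /\ rho (rowt t) <= 2 * rho (node k).
      by apply: rhom => // j; rewrite distrC.
    rewrite /d ler_pdivrMr// /B.
    apply: (le_trans (ler_pM _ _ h2 h1)); rewrite ?plummer_ge0 ?(ltW (rho0 _))//.
    by rewrite le_eqVlt; apply/orP; left; apply/eqP; ring.
- move=> p pN.
  (* All terms of the Laplacian are nonpositive: keep that of the cube of [p]. *)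
  pose l (k : K) : R := e ^+ n * rho (node k) * - (n%:R * (n%:R - 2) * (n%:R * e ^+ 2) *
    (n%:R * e ^+ 2 + normsq (p - node k)) `^ (- alpha - 2)).
  exists (2 / c * \sum_k l k).
    by apply: lap_atZ; apply: lap_at_sum => k; apply: lap_atZ; exact: lap_at_plummer.
  have pNn j : `|p 0 j| < Nn%:R.
    by apply: le_lt_trans NNn; apply: le_trans (pN j) (ler_norm _).
  have [k0 k0P] := choice (fun j => cell_ex m (pNn j)).
  pose k : K := [ffun j => k0 j].
  have pk j : `|p 0 j - node k 0 j| <= e.
    by rewrite mxE ffunE; exact: cell_dist (k0P j).
  have lk : l k <= - (c * rho (node k)).
    have := lap_plummer_mesh n3 e0 pk; rewrite -/c -(ler_pM2r (rho0 (node k))).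
    by rewrite /l; lra.
  have ls : \sum_k l k <= l k.
    rewrite (bigD1 k)//= gerDl sumr_le0// => k' _; rewrite /l mulrN oppr_le0.
    rewrite mulr_ge0 ?mulr_ge0 ?exprn_ge0 ?powR_ge0 ?(ltW (rho0 _)) ?(ltW e0)//; lra.
  have [hp _] : rho p <= 2 * rho (node k) /\ rho (node k) <= 2 * rho p.
    by apply: rhom => // j; exact: ltW.
  have h : 2 / c * \sum_k l k <= 2 / c * - (c * rho (node k)).
    by rewrite ler_wpM2l ?divr_ge0 ?(ltW c0)// (le_trans ls).
  have E : 2 / c * - (c * rho (node k)) = - (2 * rho (node k)).
    by field; rewrite gt_eqF.
  by lra.
Qed.

End discrete_potential.

(** * Convergence at infinity *)

(** Near each point the difference quotients are bounded, hence so is [f]; then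
    cover [[0, M]] by finitely many such neighbourhoods. *)
Lemma C1_halfline_bounded (R : realType) (f : R -> R) (M : R) :
  is_C1_halfline f -> exists2 C : R, 0 < C & forall t, 0 <= t <= M -> f t <= C.
Proof.
move=> [f' ff' _].
have cK : compact `[0, M]%classic by exact: segment_compact.
have /compact_near_coveringP/near_covering_withinP cov := cK.
have [|m _ Pm] := @cov nat \oo (fun m t => f t <= m%:R) _.
  move=> t; rewrite /= in_itv/= => /andP[t0 tM].
  have /cvgrPdist_lt/(_ 1 ltr01)[d /= d0 hd] := ff' t t0.
  pose b := f t + (`|f' t| + 1) * d.
  exists (ball t d, [set m | ((Num.truncn b).+1 <= m)%N]).
    by split; [exact: nbhsx_ballx|exists (Num.truncn b).+1].
  move=> [s m] [/= ts bm] /=; rewrite in_itv/= => /andP[s0 sM].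
  have bm' : b <= m%:R.
    by apply: ltW; apply: (lt_le_trans (truncnS_gt b)); rewrite ler_nat.
  apply: le_trans bm'; rewrite /b.
  have fd0 : 0 <= (`|f' t| + 1) * d by rewrite mulr_ge0 ?(ltW d0)// addr_ge0.
  have [->|st] := eqVneq s t; first by rewrite lerDl.
  have := hd s ts st; rewrite /= in_itv/= s0 => /(_ isT) h.
  have q1 : `|(f s - f t) / (s - t)| <= `|f' t| + 1.
    rewrite -(subKr (f' t) (_ / _)) (le_trans (ler_normB _ _))// lerD2l.
    exact: ltW.
  have st0 : s - t != 0 by rewrite subr_eq0.
  rewrite -lerBlDl -[leLHS](divfK st0) (le_trans (ler_norm _))// normrM.
  by apply: ler_pM => //; rewrite distrC ltW.
exists m.+1%:R => [|t tM]; first by rewrite ltr0n.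
have tK : `[0, M]%classic t by rewrite /= in_itv.
by apply: (le_trans (Pm m (leqnn m) t tK)); rewrite ler_nat.
Qed.

Lemma ler_enorm (R : realType) (n : nat) (x : 'rV[R]_n) i : `|x 0 i| <= enorm x.
Proof. by rewrite -sqrtr_sqr ler_sqrt ?normsq_ge0// ler_normsq. Qed.

Lemma enorm_gt_coord (R : realType) (n : nat) (x : 'rV[R]_n) (M : R) :
  0 <= M -> Num.sqrt n%:R * M < enorm x -> exists i, M < `|x 0 i|.
Proof.
move=> M0 xM; apply/existsP; apply: contraLR xM => /existsPn h.
have -> : Num.sqrt n%:R * M = Num.sqrt (n%:R * M ^+ 2).
  by rewrite sqrtrM// sqrtr_sqr ger0_norm.
rewrite -leNgt ler_sqrt ?mulr_ge0 ?sqr_ge0//.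
have -> : n%:R * M ^+ 2 = \sum_(i < n) M ^+ 2.
  by rewrite sumr_const card_ord mulr_natl.
apply: ler_sum => i _; rewrite -real_normK ?num_real//.
by rewrite ler_pXn2r ?nnegrE// leNgt.
Qed.

Section convergence.
Context {R : realType} {n : nat}.
Implicit Types (x y : 'rV[R]_n).

(** Coordinate [i] is changed first, so that every later point of the path shares
    it with [y] and is therefore far away. *)
Lemma le_far_point (u : 'rV[R]_n -> R) (far : set 'rV[R]_n) (d : R) x y i :
  (forall (p q : 'rV[R]_n) j, far q -> (forall k, k != j -> p 0 k = q 0 k) -> u p <= u q + d) ->
  (forall p : 'rV[R]_n, p 0 i = y 0 i -> far p) ->
  u x <= u y + n.+1%:R * d.
Proof.
move=> step fari.
(* The path: [i] and the first [m] coordinates already have their final value. *)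
pose p m : 'rV[R]_n := \row_j (if (j == i) || (j < m)%N then y 0 j else x 0 j).
have pfar m : far (p m) by apply: fari; rewrite mxE eqxx.
have up m : (m <= n)%N -> u x <= u (p m) + m.+1%:R * d.
  elim: m => [_|m IH mn].
    rewrite mul1r; apply: (step _ _ i) => // k /negbTE ki.
    by rewrite mxE ki.
  have := IH (ltnW mn); have : u (p m) <= u (p m.+1) + d.
    apply: (step _ _ (Ordinal mn)) => // k km; rewrite !mxE ltnS [(k <= m)%N]leq_eqVlt.
    have -> // : (k == m :> nat) = false.
    by apply: contraNF km => /eqP km; apply/eqP/val_inj.
  by rewrite -[m.+2]addn1 natrD; lra.
have -> : y = p n by apply/rowP => j; rewrite mxE ltn_ord orbT.
exact: up.
Qed.

Lemma cvg_to_sup_at_infinity (u : 'rV[R]_n -> R) (M : R) :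
  (forall x, 0 < u x <= M) ->
  (forall e : R, 0 < e -> exists r : R, forall x y, r < enorm y -> u x <= u y + e) ->
  exists beta : R, 0 < beta /\ u x @[x --> enorm_pinfty] --> beta.
Proof.
move=> uM ue; pose beta := sup (range u).
have hsup : has_sup (range u).
  split; first by exists (u 0); exists 0.
  by exists M => _ [x _ <-]; have /andP[] := uM x.
have ub x : u x <= beta by apply: sup_upper_bound => //; exists x.
exists beta; split.
  by apply: lt_le_trans (ub 0); have /andP[] := uM 0.
apply/cvgrPdist_le => e e0; have [r hr] := ue _ e0.
exists r => // y /= ry; rewrite ger0_norm ?subr_ge0// lerBlDl addrC.
apply: ge_sup; first by exists (u 0); exists 0.
by move=> _ [x _ <-]; rewrite addrC; exact: hr.
Qed.

End convergence.

Theorem theorem2p5 (R : realType) (D : nat) (hD : (3 <= D)%N)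
  (f : R -> R) (fC1 : is_C1_halfline f)
  (f_neq0 : ~ (forall t, 0 <= t -> f t = 0))
  (f0 : f 0 = 0) (f_gt0 : forall t, 0 < t -> 0 < f t)
  (a : R) (a_gt0 : 0 < a) (fKO : keller_osserman a f)
  (rho : 'rV[R]_D -> R) (rhoC1 : is_Ck 1 rho)
  (rho_gt0 : forall x, 0 < rho x)
  (rho_lim : newton_integral rho x @[x --> enorm_pinfty] --> 0%E)
  (u : 'rV[R]_D -> R) (uC2 : is_Ck 2 u)
  (u_bounded : bounded_fun u)
  (u_eq : forall x, laplacian u x = rho x * f (u x))
  (u_gt0 : forall x, 0 < u x) :
  exists beta : R, 0 < beta /\ u x @[x --> enorm_pinfty] --> beta.
Proof.
have [uc _] := uC2; have [rhoc _] := rhoC1.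
have [M uM] : exists M, forall x, 0 < u x <= M.
  have [M [_ hM]] := u_bounded; exists (M + 1) => x; rewrite u_gt0/=.
  by apply: le_trans (ler_norm _) (hM (M + 1) _ x I); rewrite ltrDl.
have [A A0 fA] := C1_halfline_bounded M fC1.
have [C C0 pot] := discrete_potential hD rhoc rho_gt0.
apply: (cvg_to_sup_at_infinity uM) => e e0.
pose d := e / D.+1%:R; have d0 : 0 < d by rewrite divr_gt0// ltr0n.
(* Where [A * W <= A * C * newton_integral rho] falls below [d]. *)
pose far : set 'rV[R]_D := [set q | (newton_integral rho q < (d / (A * C))%:E)%E].
have step (p q : 'rV[R]_D) j : far q -> (forall k, k != j -> p 0 k = q 0 k) -> u p <= u q + d.
  move=> farq; apply: (@reflection_comparison _ _ _ (laplacian u) M d) => //.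
  - by move=> x; exact: is_C2_lap_at.
  - by move=> x; rewrite u_eq mulr_ge0 ?ltW// ?f_gt0.
  move=> N; have [W [Wc W0 WC Wl]] := pot N.
  exists (fun x => A * W x); split.
  - by apply: continuous_mul => //; exact: continuous_const.
  - by move=> x; rewrite mulr_ge0 ?(ltW A0).
  - have AC0 : 0 < A * C by rewrite mulr_gt0.
    have : (C%:E * newton_integral rho q <= C%:E * (d / (A * C))%:E)%E.
      by rewrite lee_pmul2l ?lte_fin// ltW.
    move/(le_trans (WC q)); rewrite -EFinM lee_fin => /(ler_wpM2l (ltW A0)).
    move/le_trans; apply; rewrite le_eqVlt; apply/orP; left; apply/eqP.
    by field; rewrite !gt_eqF.
  - move=> x xN; have [l Wxl rl] := Wl x xN.
    exists (A * l); first exact: lap_atZ.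
    have fuA : f (u x) <= A by apply: fA; have /andP[ux ->] := uM x; rewrite ltW.
    rewrite u_eq; have := rho_gt0 x.
    by move: fuA rl A0; move: (f (u x)) (rho x) => F r; nra.
have AC0 : 0 < d / (A * C) by rewrite divr_gt0 ?mulr_gt0.
have [r _ rP] : \forall q \near enorm_pinfty, far q.
  by apply: (rho_lim (fun v => v < (d / (A * C))%:E)%E); exact: open_ereal_lt'.
exists (Num.sqrt D%:R * Num.max r 0) => x y /enorm_gt_coord[|i yi].
  by rewrite le_max lexx orbT.
have -> : e = D.+1%:R * d by rewrite /d mulrC divfK// pnatr_eq0.
apply: (le_far_point _ step (i := i)) => p pi; apply: rP.
apply: lt_le_trans (ler_enorm p i); rewrite pi.
by apply: le_lt_trans yi; rewrite le_max lexx.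
Qed.
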